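(* For every $n\ge1$ and every $X\in\mathfrak B^n$, the length of every cycle in the state transition diagram of $\mathfrak A(n,X)$ divides the number $c^{\star}(n)=2^{\iota(2,n)}(2^{\mathfrak c(n)}-1)$.
   Context: $\mathfrak B^n=\{0,1\}^n$ is regarded as $\mathbb F_2^n$; vectors are indexed $X=[X_0,\dots,X_{n-1}]$ with indices modulo $n$. For a rule $X\in\mathfrak B^n$, the additive cellular automaton $\mathfrak A(n,X)$ has state set $\mathfrak B^n$ and transition map the linear operator $\hat X$, $(\hat X*s)_i=\bigoplus_{k=0}^{n-1}X_k s_{i+k\bmod n}$; its state transition diagram is the directed graph on $\mathfrak B^n$ with edges $(s,\hat X*s)$. $\iota(2,n)$ is the exponent of the largest power of $2$ dividing $n$. Put $n'=n/2^{\iota(2,n)}$; then $\mathfrak c(n)=\mathrm{ord}_{n'}2$ (the least positive integer $x$ with $2^x\equiv1\ (\mathrm{mod}\ n')$) if $n'>1$, and $\mathfrak c(n)=1$ if $n'=1$. *)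

(* Defs.v *)
From HB Require Import structures.
From mathcomp Require Import all_boot all_order all_algebra.
From mathcomp Require Import fingroup cyclic.

Set Implicit Arguments.
Unset Strict Implicit.
Unset Printing Implicit Defensive.

Import GRing.Theory.

Fact ord_addm_subproof n (i k : 'I_n) : (i + k) %% n < n.
Proof. by rewrite ltn_pmod // (leq_ltn_trans (leq0n i)). Qed.

(* 'I_n carries a zmodType structure only for n of the form m.+1; this addition
   modulo n is available for every n. *)
Definition ord_addm n (i k : 'I_n) : 'I_n := Ordinal (ord_addm_subproof i k).

Definition ca_map n (X s : 'rV['F_2]_n) : 'rV['F_2]_n :=
  (\row_i \sum_(k < n) X ord0 k * s ord0 (ord_addm i k))%R.

Definition ca_diagram n (X : 'rV['F_2]_n) : rel 'rV['F_2]_n :=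
  fun s t => t == ca_map X s.

Fact mulord_exists a m : (0 < m) && coprime a m ->
  exists x, (0 < x) && (a ^ x == 1 %[mod m]).
Proof.
case/andP=> m_gt0 co_am; exists (totient m).
by rewrite totient_gt0 m_gt0 /=; apply/eqP/Euler_exp_totient.
Qed.

(* The value 0 when a is not invertible modulo m is a dummy. *)
Definition mulord m a : nat :=
  match sumbool_of_bool ((0 < m) && coprime a m) with
  | left h => ex_minn (mulord_exists h)
  | right _ => 0
  end.

Lemma mulordP m a : 0 < m -> coprime a m ->
  [/\ 0 < mulord m a, a ^ mulord m a = 1 %[mod m]
    & forall x, 0 < x -> a ^ x = 1 %[mod m] -> mulord m a <= x].
Proof.
move=> m_gt0 co_am; rewrite /mulord.
case: sumbool_of_bool => [h|]; last by rewrite m_gt0 co_am.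
case: ex_minnP => x /andP[x_gt0 /eqP ax1] x_min; split=> // y y_gt0 ay1.
by apply: x_min; rewrite y_gt0; apply/eqP.
Qed.

Definition odd_part n : nat := n %/ 2 ^ logn 2 n.

(* frak_c n >= 1 for n > 0, so the truncated subtraction in c_star is exact. *)
Definition frak_c n : nat :=
  if 1 < odd_part n then mulord (odd_part n) 2 else 1.

Definition c_star n : nat := 2 ^ logn 2 n * (2 ^ frak_c n - 1).

(* Main.v *)
Require Import Defs.
From mathcomp Require Import all_boot all_order all_algebra.
From mathcomp Require Import finfield.

(** On row vectors the transition map is right multiplication by [f(P)], where
    [f] is the polynomial with coefficients [X] and [P] is the cyclic shift.
    Over [F_2] the Frobenius endomorphism gives [f(P)^(2^j) = f(P^(2^j))].  Put
    [q = 2 ^ logn 2 n] and [Q = 2 ^ frak_c n].  Since [Q = 1] modulo the odd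
    part of [n], [q Q = q] modulo [n]; as [P^n = 1] this gives
    [f(P)^(q Q) = f(P)^q], so every [q]-th iterate is fixed by
    [q (Q - 1) = c_star n] further steps. *)

Set Implicit Arguments.
Unset Strict Implicit.
Unset Printing Implicit Defensive.

Import GRing.Theory.

(** The size of [c] is the order of [x] under [f]. Whole turns fix [x], so the remainder of [m]
    modulo this order is the index at which [x] recurs, which is 0. *)
Lemma fcycle_size_dvdn (T : finType) (f : T -> T) (c : seq T) (x : T)
    (m : nat) :
  fcycle f c -> uniq c -> x \in c -> iter m f x = x -> size c %| m.
Proof.
move=> fc Uc cx fmx; rewrite -(order_cycle fc Uc cx) /dvdn.
have fox k : iter (k * fingraph.order f x) f x = x.
  by elim: k => // k IHk; rewrite mulSn iterD IHk (iter_order_cycle fc).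
rewrite -(findex_iter (ltn_pmod m (order_gt0 f x))).
rewrite -[X in iter _ f X](fox (m %/ fingraph.order f x)) -iterD.
by rewrite addnC -divn_eq fmx findex0.
Qed.

Lemma iter_mem_fcycle (T : finType) (f : T -> T) (c : seq T) (x : T) (m : nat) :
  fcycle f c -> x \in c -> iter m f x \in c.
Proof. by move=> fc cx; rewrite -(fconnect_cycle fc cx) fconnect_iter. Qed.

Section Frobenius.
Local Open Scope ring_scope.

Lemma Fp_exprXn (p j : nat) (a : 'F_p) : prime p -> a ^+ (p ^ j) = a.
Proof.
move=> p_pr; have ap : a ^+ p = a by have := expf_card a; rewrite card_Fp.
by elim: j => [|j IHj]; rewrite ?expr1 // expnS exprM ap.
Qed.

(** Raising to the power [p ^ j] is additive in characteristic [p] and fixes the coefficients by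
    Fermat, so only the indeterminate is affected. *)
Lemma poly_Fp_exprXn (p j : nat) (f : {poly 'F_p}) :
  prime p -> f ^+ (p ^ j) = f \Po 'X^(p ^ j).
Proof.
move=> p_pr; have nat_pj : (GRing.pchar {poly 'F_p}).-nat (p ^ j)%N.
  rewrite pnatX pnatE // inE p_pr /= -polyC_natr.
  by rewrite (pcharf0 (pchar_Fp p_pr)) eqxx.
elim/poly_ind: f => [|f a IHf].
  by rewrite comp_poly0 expr0n expn_eq0 -leqn0 leqNgt prime_gt0.
rewrite exprDn_pchar // exprMn IHf -rmorphXn /= Fp_exprXn //.
by rewrite comp_polyD comp_polyM comp_polyX comp_polyC.
Qed.

Lemma horner_mx_comp_Xn (R : comNzRingType) (n k : nat) (A : 'M[R]_n.+1)
    (f : {poly R}) :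
  horner_mx A (f \Po 'X^k) = horner_mx (A ^+ k) f.
Proof.
elim/poly_ind: f => [|f a IHf]; first by rewrite comp_poly0 !rmorph0.
rewrite comp_polyD comp_polyM comp_polyX comp_polyC !rmorphD !rmorphM /= IHf.
by rewrite !horner_mx_C rmorphXn /= !horner_mx_X.
Qed.

Lemma horner_mx_Fp_exprXn (p j n : nat) (A : 'M['F_p]_n.+1) (f : {poly 'F_p}) :
  prime p -> horner_mx A f ^+ (p ^ j) = horner_mx (A ^+ (p ^ j)) f.
Proof.
move=> p_pr; rewrite -rmorphXn /= (poly_Fp_exprXn j f p_pr).
exact: horner_mx_comp_Xn.
Qed.

End Frobenius.

Section Shift.
Local Open Scope ring_scope.
Variable n : nat.

(** Oriented for multiplication on the right of row vectors: column [j] selects entry [j + 1]. *)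
Definition shift_mx : 'M['F_2]_n.+1 :=
  \matrix_(i, j) (i == ((j + 1) %% n.+1)%N :> nat)%:R.

Lemma mul_shift_mxX (s : 'rV['F_2]_n.+1) (k : nat) (i : 'I_n.+1) :
  (s *m shift_mx ^+ k) 0 i = s 0 (inord ((i + k) %% n.+1)).
Proof.
elim: k i => [|k IHk] i.
  by rewrite expr0 mulmx1 addn0 modn_small // inord_val.
rewrite exprSr mulmxA mxE.
rewrite (bigD1 (inord ((i + 1) %% n.+1))) //= big1 => [|j ne_ji].
  rewrite IHk mxE inordK ?ltn_pmod // eqxx mulr1 addr0.
  by rewrite modnDml -addnA add1n.
rewrite [shift_mx _ _]mxE (_ : (_ == _) = false) ?mulr0 //.
by apply: contraNF ne_ji => /eqP <-; rewrite inord_val.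
Qed.

Lemma shift_mxX_mod (k l : nat) :
  k = l %[mod n.+1] -> shift_mx ^+ k = shift_mx ^+ l.
Proof.
(* Rows are images of basis vectors, so the formula for the action on vectors applies. *)
move=> kl; apply/row_matrixP=> r; rewrite !rowE; apply/rowP=> i.
by rewrite !mul_shift_mxX -modnDmr kl modnDmr.
Qed.

Definition rule_poly (X : 'rV['F_2]_n.+1) : {poly 'F_2} :=
  \sum_(k < n.+1) X 0 k *: 'X^k.

Lemma ca_map_horner (X s : 'rV['F_2]_n.+1) :
  ca_map X s = s *m horner_mx shift_mx (rule_poly X).
Proof.
apply/rowP=> i; rewrite mxE /rule_poly rmorph_sum mulmx_sumr summxE.
apply: eq_bigr => k _; rewrite /= horner_mxZ rmorphXn /= horner_mx_X.
rewrite -scalemxAr mxE mul_shift_mxX; congr (_ * s _ _); apply: val_inj.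
by rewrite /= inordK // ltn_pmod.
Qed.

Lemma iter_ca_map (X s : 'rV['F_2]_n.+1) (m : nat) :
  iter m (ca_map X) s = s *m horner_mx shift_mx (rule_poly X) ^+ m.
Proof.
elim: m => [|m IHm]; first by rewrite mulmx1.
by rewrite iterS IHm ca_map_horner exprSr mulmxA.
Qed.

(** For exponents that are powers of 2, Frobenius moves the exponent onto the shift, where only its
    residue matters. *)
Lemma iter_ca_map_exp2_mod (X s : 'rV['F_2]_n.+1) (j l : nat) :
  2 ^ j = 2 ^ l %[mod n.+1] ->
  iter (2 ^ j) (ca_map X) s = iter (2 ^ l) (ca_map X) s.
Proof.
move=> jl; rewrite !iter_ca_map.
have Frob i := horner_mx_Fp_exprXn i shift_mx (rule_poly X) isT.
by rewrite (Frob j) (Frob l) (shift_mxX_mod jl).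
Qed.

End Shift.

Lemma exp2_frak_c_mod_odd_part (n : nat) :
  0 < n -> 2 ^ frak_c n = 1 %[mod odd_part n].
Proof.
move=> n_gt0; rewrite /frak_c.
have n'_gt0 : 0 < odd_part n.
  by rewrite divn_gt0 ?expn_gt0 // dvdn_leq // pfactor_dvdnn.
have odd_n' : coprime (odd_part n) 2.
  have [m m_odd n_eq] := pfactor_coprime (isT : prime 2) n_gt0.
  by rewrite /odd_part [in X in X %/ _]n_eq mulnK ?expn_gt0 // coprime_sym.
case: ltnP => [_|n'_le1]; last first.
  (* When [n] is a power of 2, the congruence is modulo 1. *)
  by have /eqP-> : odd_part n == 1 by [rewrite eqn_leq n'_le1]; rewrite !modn1.
by have [|//] := mulordP n'_gt0 (a := 2); rewrite coprime_sym.
Qed.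

Lemma exp2_logn_frak_c_mod (n : nat) :
  0 < n -> 2 ^ (logn 2 n + frak_c n) = 2 ^ logn 2 n %[mod n].
Proof.
move=> n_gt0; have n_eq : n = 2 ^ logn 2 n * odd_part n.
  by rewrite mulnC divnK // pfactor_dvdnn.
have := congr1 (muln (2 ^ logn 2 n)) (exp2_frak_c_mod_odd_part n_gt0).
by rewrite !muln_modr -n_eq muln1 -expnD.
Qed.

Theorem theorem6 (n : nat) (X : 'rV['F_2]_n) (c : seq 'rV['F_2]_n) :
  0 < n -> c != [::] -> ucycle (ca_diagram X) c -> size c %| c_star n.
Proof.
case: n X c => // n X [//|x c] _ _ /andP[cyc_c Uc].
have {}cyc_c : fcycle (ca_map X) (x :: c).
  by rewrite (eq_cycle (e' := ca_diagram X)) // => s t; rewrite /= eq_sym.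
set q := 2 ^ logn 2 n.+1.
have cx : x \in x :: c by rewrite mem_head.
(* The return time is tested at the [q]-th iterate of [x], also on the cycle: the identity obtained
   compares iterates [q * Q] and [q]. *)
apply: fcycle_size_dvdn cyc_c Uc (iter_mem_fcycle q cyc_c cx) _.
rewrite -iterD /c_star -/q mulnBr muln1 subnK ?leq_pmulr ?expn_gt0 //.
by rewrite -expnD; apply/iter_ca_map_exp2_mod/exp2_logn_frak_c_mod.
Qed.
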